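(* Let $n,k\in\mathbb{N}$. If $\Omega\subset\mathbb{R}^n_{\ge0}$ is symmetric and the toric domain $X_\Omega$ is convex, then $$c_k(X_\Omega)=\max\{\langle V(k,n),w\rangle \mid w\in\bar\partial_+\Omega\},$$ where $$V(k,n)=\Big(\lfloor k/n\rfloor,\dots,\lfloor k/n\rfloor,\underbrace{\lceil k/n\rceil,\dots,\lceil k/n\rceil}_{(k \bmod n)\text{ times}}\Big)\in\mathbb{Z}^n_{\ge 0}.$$
   Context: $\mathbb{N}=\{1,2,\dots\}$. A domain is the closure of an open subset of a Euclidean space. Let $\mu:\mathbb{C}^n=\mathbb{R}^{2n}\to\mathbb{R}^n_{\ge0}$, $\mu(z_1,\dots,z_n)=(\pi|z_1|^2,\dots,\pi|z_n|^2)$. For a domain $\Omega\subset\mathbb{R}^n_{\ge0}$ put $X_\Omega=\mu^{-1}(\Omega)$. $X_\Omega$ is convex if $\hat\Omega=\{x\in\mathbb{R}^n:(|x_1|,\dots,|x_n|)\in\Omega\}$ is compact and convex. $\Omega$ is symmetric if $(x_1,\dots,x_n)\in\Omega$ implies $(x_{\sigma(1)},\dots,x_{\sigma(n)})\in\Omega$ for all $\sigma\in S_n$. $\bar\partial_+\Omega$ is the closure of $\{w\in\partial\Omega: w\in\mathbb{R}^n_{>0}\}$. $c_k$ is the $k$-th Gutt-Hutchings capacity (defined for star-shaped domains via positive $S^1$-equivariant symplectic homology). By a theorem of Gutt and Hutchings its values on convex toric domains are $$c_k(X_\Omega)=\min\Big\{\max_{w\in\Omega}\langle v,w\rangle : v\in\mathbb{Z}^n_{\ge0},\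 \textstyle\sum_{i=1}^n v_i=k\Big\}.$$ *)

(* Defs.v *)
From mathcomp Require Import all_boot all_order all_algebra all_fingroup.
From mathcomp Require Import all_classical all_reals all_analysis.
From mathcomp Require Import complex.

Set Implicit Arguments.
Unset Strict Implicit.
Unset Printing Implicit Defensive.

Import Order.TTheory GRing.Theory Num.Theory.
Import numFieldTopology.Exports numFieldNormedType.Exports.

Local Open Scope classical_set_scope.
Local Open Scope ring_scope.

(* Attained extrema, in contrast to the library's [sup] and [inf]. *)
Definition is_max {d} {T : porderType d} (A : set T) (m : T) : Prop :=
  A m /\ ubound A m.

Definition is_min {d} {T : porderType d} (A : set T) (m : T) : Prop :=
  A m /\ lbound A m.

Section ToricDomains.
Context {R : realType} {n : nat}.
Implicit Types (Omega : set 'rV[R]_n) (w x : 'rV[R]_n) (v : 'rV[int]_n).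

Definition nonneg_orthant : set 'rV[R]_n :=
  [set x : 'rV[R]_n | forall i, 0 <= x 0 i].

Definition pos_orthant : set 'rV[R]_n :=
  [set x : 'rV[R]_n | forall i, 0 < x 0 i].

(* Nonempty, so that maxima over a domain make sense. *)
Definition is_domain Omega : Prop :=
  exists2 U : set 'rV[R]_n, open U /\ U !=set0 & Omega = closure U.

(* [ComplexField.Normc.normc] is the R-valued modulus; [`|z|] lives in R[i]. *)
Definition moment_map (z : 'rV[R[i]]_n) : 'rV[R]_n :=
  \row_i (pi * ComplexField.Normc.normc (z 0 i) ^+ 2).

Definition toric_domain Omega : set 'rV[R[i]]_n := moment_map @^-1` Omega.

Definition reflected_hull Omega : set 'rV[R]_n :=
  [set x : 'rV[R]_n | Omega (\row_i `|x 0 i|)].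

(* "X_Omega is convex" for toric domains: a condition on the reflected region
   rather than geometric convexity of X_Omega in C^n. *)
Definition convex_toric Omega : Prop :=
  compact (reflected_hull Omega) /\ convex_set (reflected_hull Omega).

Definition symmetric_region Omega : Prop :=
  forall (s : 'S_n) x, Omega x -> Omega (\row_i x 0 (s i)).

Definition boundary Omega : set 'rV[R]_n := closure Omega `\` interior Omega.

Definition boundary_plus Omega : set 'rV[R]_n :=
  closure (boundary Omega `&` pos_orthant).

Definition pairing v w : R := \sum_i (v 0 i)%:~R * w 0 i.

(* [c k X] stands for the k-th Gutt-Hutchings capacity of X, with values in the
   extended reals.  Its symplectic-homology definition is not available, so [c]
   is only constrained by the theorem of Gutt and Hutchings computing it on
   convex toric domains. *)
Definition gutt_hutchings_formula (c : nat -> set 'rV[R[i]]_n -> \bar R) :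
    Prop :=
  forall (k : nat) Omega, (0 < k)%N ->
    is_domain Omega -> Omega `<=` nonneg_orthant -> convex_toric Omega ->
    is_min
      [set s : \bar R | exists v : 'rV[int]_n,
         [/\ (forall i, 0 <= v 0 i), \sum_i v 0 i = k%:Z &
             is_max [set (pairing v w)%:E | w in Omega] s]]
      (c k (toric_domain Omega)).

End ToricDomains.

Definition V (k n : nat) : 'rV[int]_n :=
  \row_(i < n) (if (i < n - k %% n)%N
                then Num.floor (k%:R / n%:R : rat)
                else Num.ceil (k%:R / n%:R : rat)).

(* Main.v *)
Require Import Defs.
From mathcomp Require Import all_boot all_order all_algebra all_fingroup.
From mathcomp Require Import all_classical all_reals all_analysis.
From mathcomp Require Import complex.
From mathcomp Require Import ring lra zify.

(** The vector [V k n] is the most balanced way of writing [k] as a sum of [n]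
    integers: its entries differ by at most [1].  For a symmetric region, the
    support function [v |-> max <v, w>] is convex and invariant under
    permutations of [v], so it can only decrease when [v] is made more
    balanced.  Moving one unit at a time from an entry of [v] that exceeds the
    target to one that falls short of it turns any admissible [v] into [V k n]
    ([balanced_support_le]).  Hence [V k n] realises the minimum in the formula
    of Gutt and Hutchings, and the capacity is the maximum [M] of
    [<V k n, w>] over the whole of [Omega].

    It remains to see that this maximum is attained on [boundary_plus Omega].
    A maximiser [w0] may lie on a coordinate hyperplane, so it has to be
    approximated by boundary points with positive coordinates.  Choose [p] in
    [Omega] with positive coordinates and an index [i] where [V k n] is
    positive.  By convexity the points [q = t p + (1 - t) w0] with [0 < t <= 1]
    lie in [Omega], and their coordinates are positive; pushing [q] in
    direction [i] until it leaves [Omega] gives a boundary point [x]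
    ([boundary_point_above]).  Since [<V k n, x> <= M] while [<V k n, q>] is
    within [O(t)] of [M], the push has length [O(t)], so [x] tends to [w0] as
    [t] tends to [0] ([maximizer_boundary_plus]). *)

Set Implicit Arguments.
Unset Strict Implicit.
Unset Printing Implicit Defensive.

Import Order.TTheory GRing.Theory Num.Theory.
Import numFieldTopology.Exports numFieldNormedType.Exports.

Local Open Scope classical_set_scope.
Local Open Scope ring_scope.

(** * The balanced vector *)

Section BalancedVector.
Context {k n : nat}.
Hypothesis n_gt0 : (0 < n)%N.

(** When [n] divides [k] the range of indices carrying the extra unit is
    empty, so the ceiling is only ever taken of a non-integer and equals the
    floor plus one. *)
Lemma V_entry (i : 'I_n) : V k n 0 i = (k %/ n + (n - k %% n <= i))%N%:Z.
Proof.
have n0 : 0 < n%:R :> rat by rewrite ltr0n.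
have rn : (k %% n < n)%N by rewrite ltn_mod.
have kE := divn_eq k n.
rewrite mxE ltnNge; case: leqP => ik /=.
  apply: ceil_def; rewrite addn1 -addn1 PoszD addrK -!pmulrn.
  rewrite ltr_pdivlMr// ler_pdivrMr// -!natrM ltr_nat ler_nat.
  have := ltn_ord i; lia.
apply: floor_def; rewrite addn0 -[_ + 1]PoszD -!pmulrn.
by rewrite ler_pdivlMr// ltr_pdivrMr// -!natrM ltr_nat ler_nat; lia.
Qed.

Lemma V_ge0 (i : 'I_n) : 0 <= V k n 0 i.
Proof. by rewrite V_entry. Qed.

Lemma V_balanced (i j : 'I_n) : V k n 0 i <= V k n 0 j + 1.
Proof. by rewrite !V_entry; do 2!case: leqP => _; lia. Qed.

Lemma V_sum : \sum_i V k n 0 i = k%:Z.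
Proof.
have tail_count m l : (\sum_(i < m) (l <= i)%N = m - l)%N.
  elim: m => [|m IHm]; first by rewrite big_ord0.
  by rewrite big_ord_recr/= IHm; case: leqP => /=; lia.
have rn : (k %% n < n)%N by rewrite ltn_mod.
have kE := divn_eq k n.
under eq_bigr do rewrite V_entry.
rewrite -raddf_sum; congr Posz.
rewrite big_split/= sum_nat_const card_ord tail_count; lia.
Qed.

End BalancedVector.

(** * Support functions of symmetric regions *)

Section Pairing.
Context {R : realType} {n : nat}.
Implicit Types (Omega : set 'rV[R]_n) (w x p q : 'rV[R]_n) (v u : 'rV[int]_n).

Lemma pairingD v x w : pairing v (x + w) = pairing v x + pairing v w.
Proof.
by rewrite /pairing -big_split; apply: eq_bigr => i _; rewrite mxE mulrDr.
Qed.

Lemma pairingZ v (a : R) w : pairing v (a *: w) = a * pairing v w.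
Proof.
by rewrite /pairing big_distrr; apply: eq_bigr => i _; rewrite mxE mulrCA.
Qed.

Lemma pairingDl v u w : pairing (v + u) w = pairing v w + pairing u w.
Proof.
rewrite /pairing -big_split; apply: eq_bigr => i _.
by rewrite mxE intrD mulrDl.
Qed.

Lemma pairingNl v w : pairing (- v) w = - pairing v w.
Proof.
by rewrite /pairing -sumrN; apply: eq_bigr => i _; rewrite mxE intrN mulNr.
Qed.

Lemma pairing_delta (i : 'I_n) w : pairing (delta_mx 0 i) w = w 0 i.
Proof.
rewrite /pairing (bigD1 i)//= big1 ?addr0 => [|j /negPf ji].
  by rewrite mxE !eqxx mul1r.
by rewrite mxE ji andbF mul0r.
Qed.

Lemma pairing_delta_r v (i : 'I_n) :
  pairing v (delta_mx 0 i) = (v 0 i)%:~R :> R.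
Proof.
rewrite /pairing (bigD1 i)//= big1 ?addr0 => [|j /negPf ji].
  by rewrite mxE !eqxx mulr1.
by rewrite mxE ji andbF mulr0.
Qed.

Lemma pairing_continuous v : continuous (pairing v : 'rV[R]_n -> R).
Proof.
apply: continuous_big => [x|i _ x]; first exact: add_continuous.
by apply: continuousM; [exact: cst_continuous|exact: coord_continuous].
Qed.

Lemma pairing_swap v w (i j : 'I_n) : i != j ->
  pairing v (\row_l w 0 (tperm i j l)) =
  pairing v w + (v 0 i - v 0 j)%:~R * (w 0 j - w 0 i).
Proof.
move=> ij; rewrite /pairing.
rewrite (bigD1 i)//= (bigD1 j) 1?eq_sym//=.
rewrite [in RHS](bigD1 i)//= [in RHS](bigD1 j) 1?eq_sym//=.
rewrite !mxE tpermL tpermR intrB.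
rewrite (eq_bigr (fun l => (v 0 l)%:~R * w 0 l)); first by ring.
by move=> l /andP[li lj]; rewrite mxE tpermD// eq_sym.
Qed.

(** For [v i > v j], the transfer is a convex combination of [v] and of [v]
    with the entries [i] and [j] exchanged, hence its pairing with [w] is at
    most that of [v] with [w] or with the exchanged [w]. *)
Lemma transfer_support_le Omega v (i j : 'I_n) (B : R) :
  symmetric_region Omega -> v 0 j < v 0 i ->
  (forall w, Omega w -> pairing v w <= B) ->
  forall w, Omega w -> pairing (v - delta_mx 0 i + delta_mx 0 j) w <= B.
Proof.
move=> sym vij vB w ow.
have ij : i != j by apply: contraTneq vij => ->; rewrite ltxx.
rewrite !pairingDl pairingNl !pairing_delta.
have [wji|wij] := leP (w 0 j) (w 0 i); first by have := vB _ ow; lra.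
have := vB _ (sym (tperm i j) _ ow); rewrite pairing_swap// => swapB.
have d1 : 1 <= (v 0 i - v 0 j)%:~R :> R by rewrite (ler_int _ 1); lia.
have : 0 <= ((v 0 i - v 0 j)%:~R - 1) * (w 0 j - w 0 i).
  by rewrite mulr_ge0 ?subr_ge0// ltW.
lra.
Qed.

(** A surplus of [v] over [u] at [i] and a deficit at [j] force
    [v i > v j] because [u] is balanced, so transferring a unit from [i] to
    [j] is allowed by [transfer_support_le] and brings [v] closer to [u] in
    the [l^1] distance, on which the induction runs. *)
Lemma balanced_support_le Omega u v (B : R) :
  symmetric_region Omega -> (forall i j, u 0 i <= u 0 j + 1) ->
  \sum_i u 0 i = \sum_i v 0 i ->
  (forall w, Omega w -> pairing v w <= B) ->
  forall w, Omega w -> pairing u w <= B.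
Proof.
move=> sym bal.
have [m] := ubnP (\sum_i `|(v 0 i - u 0 i)%R|)%N.
elim: m v => // m IHm v; rewrite ltnS => vm uv vB.
have [->//|] := eqVneq u v => neq.
have exceeds (a b : 'rV[int]_n) : \sum_i a 0 i = \sum_i b 0 i -> a != b ->
    exists i, a 0 i < b 0 i.
  move=> ab /eqP neqab; apply: contrapT => nlt; apply: neqab; apply/rowP => i.
  have ge l : b 0 l <= a 0 l.
    by rewrite leNgt; apply/negP => lt; apply: nlt; exists l.
  apply/eqP; rewrite -subr_eq0; apply/eqP.
  apply: (@psumr_eq0P _ _ predT (fun l => a 0 l - b 0 l)) => // [l _|].
    by rewrite subr_ge0.
  by rewrite sumrB ab subrr.
have [i ui] := exceeds _ _ uv neq.
have [j uj] : exists j, v 0 j < u 0 j by apply: exceeds; rewrite // eq_sym.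
have vji : v 0 j < v 0 i by have := bal j i; lia.
have ij : i != j by apply: contraTneq vji => ->; rewrite ltxx.
apply: (IHm (v - delta_mx 0 i + delta_mx 0 j)).
- apply: leq_trans vm.
  rewrite (bigD1 i)//= [X in (_ < X)%N](bigD1 i)//= -addSn leq_add//.
    by rewrite !mxE !eqxx (negPf ij) /=; lia.
  rewrite leq_sum// => l li; rewrite !mxE !eqxx (negPf li) /=.
  by case: eqVneq => [->|]; lia.
- have dsum (l : 'I_n) : \sum_i (i == l)%:R = 1 :> int.
    by rewrite (bigD1 l)//= eqxx big1 ?addr0// => s /negPf ->.
  under [RHS]eq_bigr do rewrite !mxE eqxx /=.
  by rewrite big_split sumrB uv /= !dsum subrK.
- exact: transfer_support_le.
Qed.

End Pairing.

(** * Maximisers and the positive boundary *)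

Section Regions.
Context {R : realType} {n : nat}.
Implicit Types (Omega : set 'rV[R]_n) (w x p q : 'rV[R]_n) (v u : 'rV[int]_n).

Lemma abs_row_nonneg x : nonneg_orthant x -> \row_i `|x 0 i| = x.
Proof. by move=> x0; apply/rowP => i; rewrite mxE ger0_norm. Qed.

Lemma sub_reflected_hull Omega :
  Omega `<=` nonneg_orthant -> Omega `<=` reflected_hull Omega.
Proof.
by move=> nn x ox; rewrite /reflected_hull /= abs_row_nonneg//; exact: nn.
Qed.

Lemma convex_toric_combination Omega (t : R) x w :
  Omega `<=` nonneg_orthant -> convex_toric Omega -> 0 <= t <= 1 ->
  Omega x -> Omega w -> Omega (t *: x + (1 - t) *: w).
Proof.
move=> nn [_ cvx] /andP[t0 t1] ox ow.
have hull z : Omega z -> z \in reflected_hull Omega.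
  by move=> oz; rewrite inE; exact: sub_reflected_hull.
have := cvx _ _ (Itv01 t0 t1) (hull _ ox) (hull _ ow).
rewrite inE /reflected_hull /= abs_row_nonneg// => i.
by rewrite !mxE addr_ge0// mulr_ge0// ?subr_ge0//; exact: nn.
Qed.

Lemma domain_closure Omega : is_domain Omega -> closure Omega = Omega.
Proof.
by move=> [U _ ->]; rewrite -(closure_id _).1//; exact: closed_closure.
Qed.

Lemma convex_toric_compact Omega :
  is_domain Omega -> Omega `<=` nonneg_orthant -> convex_toric Omega ->
  compact Omega.
Proof.
move=> [U _ UE] nn [cpt _]; apply: subclosed_compact cpt _.
  by rewrite UE; exact: closed_closure.
exact: sub_reflected_hull.
Qed.

(** An open subset of the nonnegative orthant avoids its faces, since every
    point can be moved a little in the negative direction. *)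
Lemma domain_pos_point Omega :
  is_domain Omega -> Omega `<=` nonneg_orthant ->
  exists2 p, Omega p & pos_orthant p.
Proof.
move=> [U [oU [p Up]] ->] nn.
exists p => [|i]; first exact: subset_closure.
have /nbhs_ballP[e /= e0 eU] := open_nbhs_nbhs (conj oU Up).
have : U (p - (e / 2) *: const_mx 1).
  apply: eU; split=> // a b; rewrite ord1 /ball/= !mxE mulr1 opprB addrC subrK.
  by rewrite gtr0_norm; lra.
move=> /subset_closure/nn/(_ i); rewrite !mxE mulr1; lra.
Qed.

(** By compactness the [i]-th coordinate has a maximum over the points of
    [Omega] on the line through [q] parallel to the [i]-th axis; an interior
    point of [Omega] could be moved further up that line. *)
Lemma boundary_point_above Omega q (i : 'I_n) :
  compact Omega -> Omega q ->
  exists2 s : R, 0 <= s & boundary Omega (q + s *: delta_mx 0 i).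
Proof.
move=> cpt oq.
pose L := \bigcap_(j in [set j | j != i]) [set x : 'rV[R]_n | x 0 j = q 0 j].
have closedL : closed L.
  apply: closed_bigI => j _.
  apply: (@preimage_closed _ _ (fun x : 'rV[R]_n => x 0 j) [set q 0 j]).
    by move=> x _; exact: coord_continuous.
  exact: closed_eq.
have [|||x] := @EVT_max_rV R n (fun x => x 0 i) (Omega `&` L).
- by exists q; split.
- exact: compact_closedI.
- by apply: continuous_subspaceT => x; exact: coord_continuous.
rewrite inE => -[ox Lx] xmax.
have xE : x = q + (x 0 i - q 0 i) *: delta_mx 0 i.
  apply/rowP => j; rewrite !mxE eqxx /=.
  have [->|ji] := eqVneq j i; first by rewrite mulr1 addrC subrK.
  by rewrite mulr0 addr0; exact: Lx.
exists (x 0 i - q 0 i).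
  by rewrite subr_ge0 xmax// inE.
rewrite -xE; split; first exact: subset_closure.
move=> /nbhs_ballP[e /= e0 eO].
pose y := x + (e / 2) *: delta_mx 0 i.
have oy : Omega y.
  apply: eO; split=> // a b; rewrite ord1 /ball/= !mxE eqxx.
  rewrite opprD addrA subrr sub0r normrN; case: (_ == _); rewrite ?mulr1 ?mulr0 ?normr0//.
  by rewrite gtr0_norm; lra.
have Ly : L y.
  by move=> j /= ji; rewrite !mxE (negPf ji) andbF mulr0 addr0; exact: Lx.
have := xmax y; rewrite inE => /(_ (conj oy Ly)).
by rewrite !mxE !eqxx mulr1; lra.
Qed.

(** A maximiser of [<u, .>] is the limit of the points obtained by contracting
    slightly towards a positive point and then pushing along an axis on which
    [u] is positive: maximality bounds the length of the push. *)
Lemma maximizer_boundary_plus Omega u (i : 'I_n) w :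
  is_domain Omega -> Omega `<=` nonneg_orthant -> convex_toric Omega ->
  0 < u 0 i -> Omega w -> (forall x, Omega x -> pairing u x <= pairing u w) ->
  boundary_plus Omega w.
Proof.
move=> dom nn cvx ui ow wmax.
have [p op ppos] := domain_pos_point dom nn.
have cpt := convex_toric_compact dom nn cvx.
move=> W /nbhs_ballP[e /= e0 eW].
pose gap := pairing u w - pairing u p.
have gap0 : 0 <= gap by rewrite subr_ge0 wmax.
(* [t * C] will bound all coordinates of the displacement from [w]. *)
pose C := gap + \sum_j `|p 0 j - w 0 j|.
have C0 : 0 <= C by rewrite addr_ge0// sumr_ge0.
pose t := e / (C + e).
have Ce0 : 0 < C + e by rewrite ltr_wpDl.
have t0 : 0 < t by rewrite divr_gt0.
have t1 : t <= 1 by rewrite ler_pdivrMr// mul1r lerDr.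
have tC : t * C < e.
  by rewrite /t mulrAC ltr_pdivrMr// (mulrDr e C e) ltrDl mulr_gt0.
pose q := t *: p + (1 - t) *: w.
have oq : Omega q by apply: convex_toric_combination; rewrite // ltW.
have qpos : pos_orthant q.
  move=> j; rewrite !mxE ltr_pwDl//; first by rewrite mulr_gt0 ?ppos.
  by rewrite mulr_ge0 ?subr_ge0//; exact: nn.
have [s s0 bs] := boundary_point_above i cpt oq.
pose x := q + s *: delta_mx 0 i.
have s_le : s <= t * gap.
  have ox : Omega x by rewrite -(domain_closure dom); exact: bs.1.
  have := wmax _ ox.
  rewrite /x /q !pairingD !pairingZ pairing_delta_r /gap.
  have u1 : 1 <= (u 0 i)%:~R :> R by rewrite (ler_int _ 1); lia.
  have : 0 <= s * ((u 0 i)%:~R - 1) by rewrite mulr_ge0// subr_ge0.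
  lra.
exists x; split.
  split => // j; rewrite mxE ltr_pwDl//.
  by rewrite !mxE mulr_ge0.
apply: eW; split=> // a j; rewrite ord1 /ball/=; apply: le_lt_trans tC.
have -> : w 0 j - x 0 j = - (t * (p 0 j - w 0 j) + s * (j == i)%:R).
  by rewrite !mxE eqxx /=; ring.
rewrite normrN (le_trans (ler_normD _ _))// normrM (gtr0_norm t0).
rewrite /C mulrDr addrC lerD//.
  rewrite ger0_norm ?mulr_ge0//; apply: le_trans s_le.
  by case: (_ == _); rewrite ?mulr1 ?mulr0.
by rewrite ler_pM2l// (bigD1 j)//= lerDl sumr_ge0.
Qed.

End Regions.

(** * The capacity of a symmetric convex toric domain *)

Theorem theorem1p6 (R : realType) (n k : nat) (hn : (0 < n)%N) (hk : (0 < k)%N)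
  (c : nat -> set 'rV[R[i]]_n -> \bar R) (hc : gutt_hutchings_formula c)
  (Omega : set 'rV[R]_n) (hdom : is_domain Omega)
  (hnonneg : Omega `<=` nonneg_orthant)
  (hsym : symmetric_region Omega) (hconv : convex_toric Omega) :
  is_max [set (pairing (V k n) w)%:E | w in boundary_plus Omega]
         (c k (toric_domain Omega)).
Proof.
have cpt := convex_toric_compact hdom hnonneg hconv.
have [p op _] := domain_pos_point hdom hnonneg.
have [|||w] := @EVT_max_rV R n (pairing (V k n)) Omega => //.
- by exists p.
- by apply: continuous_subspaceT; exact: pairing_continuous.
rewrite inE => ow wmax'.
have wmax x : Omega x -> pairing (V k n) x <= pairing (V k n) w.
  by move=> ox; apply: wmax'; rewrite inE.
have cE : c k (toric_domain Omega) = (pairing (V k n) w)%:E.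
  have [[v [_ vk [[x ox <-] vmax]]] cmin] := hc _ _ hk hdom hnonneg hconv.
  apply/eqP; rewrite eq_le; apply/andP; split.
    apply: cmin; exists (V k n); split; [exact: V_ge0|exact: V_sum|].
    split; first by exists w.
    by move=> _ [y oy <-]; rewrite lee_fin wmax.
  rewrite lee_fin; apply: (@balanced_support_le _ _ _ _ v _ hsym) ow.
  - exact: V_balanced.
  - by rewrite vk V_sum.
  - by move=> y oy; rewrite -lee_fin; apply: vmax; exists y.
have [i Vi] : exists i, 0 < V k n 0 i.
  apply: contrapT => nV.
  have : \sum_i V k n 0 i <= 0.
    rewrite sumr_le0// => i _; rewrite leNgt; apply/negP => Vi.
    by apply: nV; exists i.
  by rewrite V_sum// lez_nat leqNgt hk.
rewrite cE; split.
  by exists w => //; exact: maximizer_boundary_plus Vi ow wmax.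
move=> _ [x bx <-]; rewrite lee_fin wmax// -(domain_closure hdom).
by apply: closure_subset bx => y [[+ _] _]; rewrite domain_closure.
Qed.
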